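(* For Independent Set in the standard model, the strict competitive ratio is $n-1$, where $n\ge 2$ is the number of vertices of the input graph. That is: (i) there is an online algorithm $\mathrm{ALG}$ in the standard model such that $\mathrm{OPT}(\sigma)\le (n-1)\,\mathrm{ALG}(\sigma)$ for every input $\sigma$ whose number $n$ of vertices is at least $2$; and (ii) for every online algorithm $\mathrm{ALG}$ in the standard model and every integer $n\ge 2$, every real $c\ge 0$ such that $\mathrm{OPT}(\sigma)\le c\,\mathrm{ALG}(\sigma)$ for all inputs $\sigma$ with $n$ vertices satisfies $c\ge n-1$.
   Context: Online Independent Set (vertex arrival). An input $\sigma$ is a finite simple undirected graph $G=(V,E)$ together with an ordering of its vertices. Vertices arrive one by one in this order; when a vertex arrives, all edges between it and previously arrived vertices are revealed. All online algorithms are deterministic: each decision depends only on the part of the input revealed so far (in particular $n=|V|$ is not known in advance). After each arrival the algorithm maintains a set of currently accepted vertices, which must be an independent set of the graph revealed so far. $\mathrm{ALG}(\sigma)$ is the number of accepted vertices at the end of the input, and $\mathrm{OPT}(\sigma)$ is the maximum cardinality of an independent set of $G$; the objective is maximization. Standard model: upon arrival of a vertex, the algorithm must immediately and irrevocably either accept or reject it. *)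

(* Defs.v *)
From mathcomp Require Import all_boot all_order all_algebra.
From mathcomp Require Import reals.

Set Implicit Arguments.
Unset Strict Implicit.
Unset Printing Implicit Defensive.

Record input := Input {
  vertex : finType;
  adj : rel vertex;
  adj_sym : symmetric adj;
  adj_irr : irreflexive adj;
  arrival : seq vertex;
  arrival_uniq : uniq arrival;
  arrival_all : forall v : vertex, v \in arrival
}.

Definition nvert (sigma : input) : nat := #|vertex sigma|.

Definition independent (sigma : input) (S : {set vertex sigma}) : bool :=
  [forall x in S, forall y in S, ~~ adj x y].

Definition OPT (sigma : input) : nat :=
  \max_(S : {set vertex sigma} | independent S) #|S|.

(* What is known after t arrivals: one row per arrived vertex v, in order of
   arrival, listing whether v is adjacent to each of the vertices that arrived
   before v.  Neither the names of the vertices nor the total number of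
   vertices are part of this information. *)
Definition revealed (sigma : input) (t : nat) : seq bitseq :=
  [seq [seq adj u v | u <- take (index v (arrival sigma)) (arrival sigma)]
     | v <- take t (arrival sigma)].

(* The decision on v is a function of what is revealed at the arrival of v,
   that is, after (index v (arrival sigma)).+1 arrivals.  The algorithm being
   deterministic, its earlier decisions are themselves functions of the
   revealed information, hence need not be passed as arguments. *)
Definition accepts (decide : seq bitseq -> bool) (sigma : input)
    (v : vertex sigma) : bool :=
  decide (revealed sigma (index v (arrival sigma)).+1).

(* The vertices accepted among the first t arrivals: a decision is taken once,
   at the arrival of the vertex, and never revised. *)
Definition accepted (decide : seq bitseq -> bool) (sigma : input) (t : nat) :
    {set vertex sigma} :=
  [set v in take t (arrival sigma) | accepts decide v].

(* The graph revealed after t arrivals is the subgraph induced by these t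
   vertices, so independence in it is independence in the whole graph. *)
Record standard_algorithm := StandardAlgorithm {
  decide :> seq bitseq -> bool;
  decide_feasible : forall (sigma : input) (t : nat),
    t <= nvert sigma -> independent (accepted decide sigma t)
}.

Definition ALG (A : standard_algorithm) (sigma : input) : nat :=
  #|accepted A sigma (nvert sigma)|.

(* Main.v *)
(** Upper bound: the greedy algorithm always accepts the first vertex, and it
    accepts everything when the graph has no edge; otherwise OPT <= n - 1.
    Lower bound: the adversary presents isolated vertices until one of them, k,
    is accepted, and makes every later vertex adjacent to k alone.  The
    algorithm is then stuck with k, while all the other vertices form an
    independent set. *)

Require Import Defs.
From mathcomp Require Import all_boot all_order all_algebra.
From mathcomp Require Import reals.
Import Order.TTheory GRing.Theory Num.Theory.
Local Open Scope ring_scope.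

Set Implicit Arguments.
Unset Strict Implicit.
Unset Printing Implicit Defensive.

Local Open Scope nat_scope.

Lemma mem_take_arrival (sigma : input) t (v : vertex sigma) :
  (v \in take t (arrival sigma)) = (index v (arrival sigma) < t).
Proof. by rewrite in_take // arrival_all. Qed.

Lemma size_arrival (sigma : input) : size (arrival sigma) = nvert sigma.
Proof.
rewrite /nvert -(card_uniqP (arrival_uniq sigma)).
by apply: eq_card => v; rewrite arrival_all.
Qed.

Lemma mem_accepted d (sigma : input) (v : vertex sigma) :
  (v \in accepted d sigma (nvert sigma)) = accepts d v.
Proof. by rewrite inE mem_take_arrival -size_arrival index_mem arrival_all. Qed.

Lemma independentP (sigma : input) (S : {set vertex sigma}) :
  reflect {in S &, forall x y, ~~ adj x y} (independent S).
Proof.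
apply: (iffP 'forall_in_forall_inP) => indS x; last by move=> xS y; apply: indS.
by move=> y xS; apply: indS.
Qed.

(** A vertex with any earlier neighbour is refused, even if that neighbour was itself refused. The
    decision thus reads only the newest row, with no need to recompute earlier decisions. *)
Definition greedy_decide (rows : seq bitseq) : bool :=
  true \notin last [::] rows.

Lemma accepts_greedy (sigma : input) (v : vertex sigma) :
  accepts greedy_decide v =
  all (fun u => ~~ adj u v) (take (index v (arrival sigma)) (arrival sigma)).
Proof.
rewrite /accepts /greedy_decide /revealed (take_nth v) ?index_mem ?arrival_all //.
rewrite map_rcons last_rcons nth_index ?arrival_all //.
rewrite -has_pred1 has_map -all_predC.
by apply: eq_all => u /=; case: adj.
Qed.

Lemma greedy_feasible (sigma : input) (t : nat) :
  t <= nvert sigma -> independent (accepted greedy_decide sigma t).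
Proof.
move=> _; apply/independentP => x y; rewrite !inE => /andP[_ xacc] /andP[_ yacc].
wlog xy : x y xacc yacc / index x (arrival sigma) <= index y (arrival sigma).
  move=> IH; case/orP: (leq_total (index x (arrival sigma)) (index y (arrival sigma))).
    exact: IH.
  by rewrite adj_sym; apply: IH.
move: xy; rewrite leq_eqVlt => /orP[/eqP exy|xy].
  have -> : x = y by rewrite -(nth_index x (arrival_all x)) exy nth_index ?arrival_all.
  by rewrite adj_irr.
move: yacc; rewrite accepts_greedy => /allP; apply.
by rewrite mem_take_arrival.
Qed.

Definition greedy := StandardAlgorithm greedy_feasible.

Lemma greedy_ratio (sigma : input) :
  2 <= nvert sigma -> OPT sigma <= (nvert sigma).-1 * ALG greedy sigma.
Proof.
move=> n2; apply/bigmax_leqP => S /independentP indS.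
have [S_lt|S_ge] := ltnP #|S| (nvert sigma).
  apply: (@leq_trans (nvert sigma).-1); first by rewrite -ltnS prednK // ltnW.
  apply: leq_pmulr; apply/card_gt0P.
  (* The first vertex has an empty row, so it is accepted. *)
  case arrE: (arrival sigma) => [|v s].
    by move: n2; rewrite -size_arrival arrE.
  by exists v; rewrite mem_accepted accepts_greedy arrE /= eqxx take0.
have S_full : S = setT.
  by apply/eqP; rewrite eqEcard subsetT cardsT.
suff -> : ALG greedy sigma = nvert sigma.
  (* Here [2 <= n] matters: it makes the factor [n.-1] positive. *)
  apply: leq_trans (max_card _) _; apply: leq_pmull.
  by rewrite -ltnS prednK // ltnW.
rewrite /ALG -[RHS]cardsT; apply: eq_card => v; rewrite mem_accepted inE.
by rewrite accepts_greedy; apply/allP => u _; apply: indS; rewrite S_full inE.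
Qed.

(* [k] is not required to be a vertex: the graph has no edge when [n <= k],
   the case of an algorithm that never accepts an isolated vertex. *)
Definition late_star_adj n k : rel 'I_n :=
  fun u v => (u == k :> nat) && (k < v) || (v == k :> nat) && (k < u).

Lemma late_star_sym n k : symmetric (@late_star_adj n k).
Proof. by move=> u v; rewrite /late_star_adj orbC. Qed.

Lemma late_star_irr n k : irreflexive (@late_star_adj n k).
Proof. by move=> u; rewrite /late_star_adj orbb; case: ltngtP. Qed.

Definition late_star n k : input :=
  Input (@late_star_sym n k) (@late_star_irr n k) (enum_uniq 'I_n)
    (mem_enum 'I_n).

Lemma nvert_late_star n k : nvert (late_star n k) = n.
Proof. exact: card_ord. Qed.

(** Edges at [k] show up only in the rows of vertices after [k]. The bound [k.+1] includes the
    arrival of [k], so that the decision on [k] itself is covered. *)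
Lemma revealed_late_star n k l t :
  t <= k.+1 -> t <= l.+1 ->
  revealed (late_star n k) t = revealed (late_star n l) t.
Proof.
move=> tk tl; apply/eq_in_map => v; rewrite (@mem_take_arrival (late_star n k)).
rewrite /= index_enum_ord => vt; apply/eq_in_map => u.
rewrite (@mem_take_arrival (late_star n k)) /= index_enum_ord => uv.
have noadj m : t <= m.+1 -> late_star_adj m u v = false.
  move=> tm; have vm : v <= m by rewrite -ltnS (leq_trans vt).
  by rewrite /late_star_adj (ltn_eqF (leq_trans uv vm)) [m < u]ltnNge
             (ltnW (leq_trans uv vm)) andbF.
by rewrite !noadj.
Qed.

Lemma OPT_late_star n k : n.-1 <= OPT (late_star n k).
Proof.
pose S : {set vertex (late_star n k)} := [set v : 'I_n | v != k :> nat].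
have indS : independent S.
  apply/independentP => x y; rewrite !inE /= /late_star_adj.
  by move=> /negbTE -> /negbTE ->.
apply: (bigop.bigmax_sup S) => //.
(* Only the centre is left out, and nothing at all when [n <= k]. *)
have Sc_le1 : #|~: S| <= 1.
  apply/card_le1_eqP => x y; rewrite !inE !negbK => /eqP xk /eqP yk.
  by apply: val_inj; rewrite /= xk yk.
rewrite -{1}(nvert_late_star n k) /nvert -(cardsC S) -subn1 leq_subLR addnC.
by rewrite leq_add2r.
Qed.

Lemma ALG_late_star (A : standard_algorithm) n :
  exists k, ALG A (late_star n k) <= 1.
Proof.
(* [late_star n n] is edgeless. The centre [k] is the first vertex accepted there, or [n] if there
   is none. *)
pose P (v : 'I_n) := @accepts A (late_star n n) v.
pose k := find P (enum 'I_n); exists k.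
have kn : k <= n by rewrite -[leqRHS]size_enum_ord find_size.
have acceptsE (v : 'I_n) : v <= k -> @accepts A (late_star n k) v = P v.
  move=> vk; rewrite /P /accepts /= index_enum_ord.
  by rewrite (@revealed_late_star _ k n) // ltnS (leq_trans vk).
suff acc_k (v : 'I_n) : @accepts A (late_star n k) v -> v = k :> nat.
  apply/card_le1_eqP => x y; rewrite !mem_accepted => /acc_k xk /acc_k yk.
  by apply: val_inj; rewrite /= xk yk.
(* Acceptance before [k] contradicts the minimality of [k]; acceptance after [k] contradicts
   feasibility, since [k] is then an accepted neighbour. *)
move=> acc_v; case: (ltngtP v k) => // [vk|kv].
  have := before_find v vk; rewrite nth_ord_enum -acceptsE ?acc_v //.
  exact: ltnW.
have kn' : k < n := ltn_trans kv (ltn_ord v).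
pose ko := Ordinal kn'.
have acc_ko : @accepts A (late_star n k) ko.
  rewrite acceptsE // -(nth_ord_enum v ko) /= nth_find //.
  by rewrite has_find size_enum_ord.
have /independentP indA := decide_feasible A (leqnn (nvert (late_star n k))).
have := indA ko v; rewrite !mem_accepted => /(_ acc_ko acc_v).
by rewrite /= /late_star_adj /= eqxx kv.
Qed.

Local Close Scope nat_scope.

Theorem theorem1 (R : realType) :
  (exists A : standard_algorithm, forall sigma : input,
     (2 <= nvert sigma)%N ->
     (OPT sigma)%:R <= ((nvert sigma)%:R - 1) * (ALG A sigma)%:R :> R)
  /\
  (forall (A : standard_algorithm) (n : nat), (2 <= n)%N ->
   forall c : R, 0 <= c ->
     (forall sigma : input, nvert sigma = n ->
        (OPT sigma)%:R <= c * (ALG A sigma)%:R) ->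
     n%:R - 1 <= c).
Proof.
have predR (n : nat) : (2 <= n)%N -> n%:R - 1 = n.-1%:R :> R.
  by case: n => // n _; rewrite -addn1 natrD addrK addn1.
split=> [|A n n2 c c0 ratio].
  exists greedy => sigma n2.
  by rewrite predR // -natrM ler_nat greedy_ratio.
have [k ALG_le1] := ALG_late_star A n.
rewrite predR //; apply: (@le_trans _ _ (OPT (late_star n k))%:R).
  by rewrite ler_nat OPT_late_star.
apply: le_trans (ratio _ (nvert_late_star n k)) _.
(* Since [0 <= c], the bound [ALG <= 1] suffices, and the case [ALG = 0] needs no separate
   treatment. *)
by rewrite ler_piMr // -[1]/(1%:R) ler_nat.
Qed.
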